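(* Let $A$ be a set of actions containing $\tau$ and $(S,\to)$ a labelled transition system with labels from $A$. Then the relation $\simeq_{D_3}$ on $S$ (defined in the context) is an equivalence relation.
   Context: $s\xrightarrow{a}s'$ means $(s,a,s')\in\to$; $s\xrightarrow{(a)}s'$ means ''$s\xrightarrow{a}s'$, or ($a=\tau$ and $s=s'$)''; $\twoheadrightarrow$ is the reflexive–transitive closure of $\xrightarrow{\tau}$; $\omega=\{0,1,\dots\}$. For a binary relation $R$ on $S$: (T) if $sRt$ and $s\xrightarrow{a}s'$, then there are $t'',t'$ with $t\twoheadrightarrow t''\xrightarrow{(a)}t'$, $sRt''$ and $s'Rt'$. (D$_3$) if $sRt$ and $(s_k)_{k\in\omega}$ is an infinite sequence with $s=s_0$ and $s_k\xrightarrow{\tau}s_{k+1}$ for all $k$, then there are an infinite sequence $(t_\ell)_{\ell\in\omega}$ and a map $\sigma:\omega\to\omega$ with $t=t_0$, $t_\ell\xrightarrow{\tau}t_{\ell+1}$ and $s_{\sigma(\ell)}Rt_\ell$ for all $\ell$. $s\simeq_{D_3}t$ iff there is a symmetric relation $R$ satisfying (T) and (D$_3$) with $sRt$. *)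

(* Defs.v *)
From Stdlib Require Export Relations.

Section LTS.

Context {A : Type} (tau : A) {State : Type} (trans : State -> A -> State -> Prop).

Definition opt_step (s : State) (a : A) (s' : State) : Prop :=
  trans s a s' \/ (a = tau /\ s = s').

Definition tau_steps : relation State :=
  clos_refl_trans State (fun s s' => trans s tau s').

Definition cond_T (R : relation State) : Prop :=
  forall s t a s', R s t -> trans s a s' ->
    exists t'' t', tau_steps t t'' /\ opt_step t'' a t' /\ R s t'' /\ R s' t'.

(* The map sigma is arbitrary: no monotonicity is required. *)
Definition cond_D3 (R : relation State) : Prop :=
  forall s t (u : nat -> State), R s t ->
    s = u 0 -> (forall k, trans (u k) tau (u (S k))) ->
    exists (v : nat -> State) (sigma : nat -> nat),
      t = v 0 /\ (forall l, trans (v l) tau (v (S l)) /\ R (u (sigma l)) (v l)).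

Definition bisim_D3 : relation State := fun s t =>
  exists R : relation State,
    symmetric State R /\ cond_T R /\ cond_D3 R /\ R s t.

End LTS.

(* Main.v *)
(** In (T) a [tau]-step may be matched by no step at all, so (T) lifts to the
    sequences of [tau]-steps occurring in its own conclusion and is therefore
    preserved by composition; (D3) is preserved because index maps compose.
    Both conditions are also preserved by unions, so the union of all
    bisimulations is the largest one; it contains its composite with itself,
    which is again a bisimulation. *)
Require Import Defs.

Section RelationOperations.

Context {X : Type}.

Definition rel_compose (R1 R2 : relation X) : relation X :=
  fun x z => exists y, R1 x y /\ R2 y z.

Definition rel_bigunion (F : relation X -> Prop) : relation X :=
  fun x y => exists R, F R /\ R x y.

Lemma inclusion_bigunion (F : relation X -> Prop) (R : relation X) :
  F R -> inclusion X R (rel_bigunion F).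
Proof.
  intros FR x y Rxy; now exists R.
Qed.

Lemma symmetric_compose_self (R : relation X) :
  symmetric X R -> symmetric X (rel_compose R R).
Proof.
  intros symR x z (y & Rxy & Ryz); exists y; split; now apply symR.
Qed.

Lemma symmetric_bigunion (F : relation X -> Prop) :
  (forall R, F R -> symmetric X R) -> symmetric X (rel_bigunion F).
Proof.
  intros symF x y (R & FR & Rxy).
  exists R; split; [exact FR | now apply (symF R FR)].
Qed.

End RelationOperations.

Section Bisimulation.

Context {A : Type} (tau : A) {State : Type}
  (trans : State -> A -> State -> Prop).

Local Notation opt_step := (opt_step tau trans).
Local Notation tau_steps := (tau_steps tau trans).
Local Notation cond_T := (cond_T tau trans).
Local Notation cond_D3 := (cond_D3 tau trans).
Local Notation bisim_D3 := (bisim_D3 tau trans).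

Lemma opt_step_tau_steps s s' : opt_step s tau s' -> tau_steps s s'.
Proof.
  intros [step | [_ <-]]; [now apply rt_step | apply rt_refl].
Qed.

Lemma cond_T_opt_step (R : relation State) s t a s' :
  cond_T R -> R s t -> opt_step s a s' ->
  exists t'' t', tau_steps t t'' /\ opt_step t'' a t' /\ R s t'' /\ R s' t'.
Proof.
  intros TR Rst [step | [-> <-]].
  - exact (TR _ _ _ _ Rst step).
  - exists t, t; repeat split; try assumption.
    + apply rt_refl.
    + now right.
Qed.

Lemma cond_T_tau_steps (R : relation State) s t s' :
  cond_T R -> R s t -> tau_steps s s' ->
  exists t', tau_steps t t' /\ R s' t'.
Proof.
  intros TR Rst steps; revert t Rst.
  induction steps as [s s' step | s | s s1 s' _ IH1 _ IH2]; intros t Rst.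
  - destruct (TR _ _ _ _ Rst step) as (t'' & t' & to_t'' & to_t' & _ & Rs't').
    exists t'; split; [|exact Rs't'].
    apply rt_trans with t''; [exact to_t'' | now apply opt_step_tau_steps].
  - exists t; split; [apply rt_refl | exact Rst].
  - destruct (IH1 _ Rst) as (t1 & to_t1 & Rs1t1).
    destruct (IH2 _ Rs1t1) as (t' & to_t' & Rs't').
    exists t'; split; [now apply rt_trans with t1 | exact Rs't'].
Qed.

Lemma cond_T_eq : cond_T eq.
Proof.
  intros s t a s' <- step; exists s, s'; repeat split.
  - apply rt_refl.
  - now left.
Qed.

Lemma cond_T_compose (R1 R2 : relation State) :
  cond_T R1 -> cond_T R2 -> cond_T (rel_compose R1 R2).
Proof.
  intros TR1 TR2 s u a s' (t & R1st & R2tu) step.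
  destruct (TR1 _ _ _ _ R1st step)
    as (t'' & t' & to_t'' & to_t' & R1st'' & R1s't').
  destruct (cond_T_tau_steps _ _ _ _ TR2 R2tu to_t'')
    as (u1 & to_u1 & R2t''u1).
  destruct (cond_T_opt_step _ _ _ _ _ TR2 R2t''u1 to_t')
    as (u'' & u' & to_u'' & to_u' & R2t''u'' & R2t'u').
  exists u'', u'; repeat split.
  - now apply rt_trans with u1.
  - exact to_u'.
  - now exists t''.
  - now exists t'.
Qed.

Lemma cond_T_bigunion (F : relation State -> Prop) :
  (forall R, F R -> cond_T R) -> cond_T (rel_bigunion F).
Proof.
  intros TF s t a s' (R & FR & Rst) step.
  destruct (TF R FR _ _ _ _ Rst step)
    as (t'' & t' & to_t'' & to_t' & Rst'' & Rs't').
  exists t'', t'; repeat split; try assumption;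
    now apply (inclusion_bigunion F R FR).
Qed.

Lemma cond_D3_eq : cond_D3 eq.
Proof.
  intros s t u <- s_u0 u_path; exists u, (fun l => l); now repeat split.
Qed.

Lemma cond_D3_compose (R1 R2 : relation State) :
  cond_D3 R1 -> cond_D3 R2 -> cond_D3 (rel_compose R1 R2).
Proof.
  intros DR1 DR2 s t u (r & R1sr & R2rt) s_u0 u_path.
  destruct (DR1 _ _ u R1sr s_u0 u_path) as (w & rho & r_w0 & w_path).
  destruct (DR2 _ _ w R2rt r_w0 (fun l => proj1 (w_path l)))
    as (v & sigma & t_v0 & v_path).
  exists v, (fun l => rho (sigma l)); split; [exact t_v0 | intros l; split].
  - apply v_path.
  - exists (w (sigma l)); split; [apply w_path | apply v_path].
Qed.

Lemma cond_D3_bigunion (F : relation State -> Prop) :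
  (forall R, F R -> cond_D3 R) -> cond_D3 (rel_bigunion F).
Proof.
  intros DF s t u (R & FR & Rst) s_u0 u_path.
  destruct (DF R FR _ _ u Rst s_u0 u_path) as (v & sigma & t_v0 & v_path).
  exists v, sigma; split; [exact t_v0 | intros l; split].
  - apply v_path.
  - apply (inclusion_bigunion F R FR), v_path.
Qed.

Definition D3_bisimulation (R : relation State) : Prop :=
  symmetric State R /\ cond_T R /\ cond_D3 R.

Lemma D3_bisimulation_eq : D3_bisimulation eq.
Proof.
  split; [|split].
  - exact (@eq_sym State).
  - apply cond_T_eq.
  - apply cond_D3_eq.
Qed.

Lemma D3_bisimulation_compose_self (R : relation State) :
  D3_bisimulation R -> D3_bisimulation (rel_compose R R).
Proof.
  intros (symR & TR & DR); split; [|split].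
  - now apply symmetric_compose_self.
  - now apply cond_T_compose.
  - now apply cond_D3_compose.
Qed.

Lemma D3_bisimulation_bigunion (F : relation State -> Prop) :
  (forall R, F R -> D3_bisimulation R) -> D3_bisimulation (rel_bigunion F).
Proof.
  intros bisimF; split; [|split].
  - apply symmetric_bigunion; apply bisimF.
  - apply cond_T_bigunion; apply bisimF.
  - apply cond_D3_bigunion; apply bisimF.
Qed.

Lemma bisim_D3_iff_bigunion s t :
  bisim_D3 s t <-> rel_bigunion D3_bisimulation s t.
Proof.
  split.
  - intros (R & symR & TR & DR & Rst); now exists R.
  - intros (R & (symR & TR & DR) & Rst); now exists R.
Qed.

Lemma bisim_D3_refl : reflexive State bisim_D3.
Proof.
  intros s; apply bisim_D3_iff_bigunion.
  now apply (inclusion_bigunion _ eq D3_bisimulation_eq).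
Qed.

Lemma bisim_D3_sym : symmetric State bisim_D3.
Proof.
  intros s t bisim_st; apply bisim_D3_iff_bigunion, symmetric_bigunion.
  - now intros R [symR _].
  - now apply bisim_D3_iff_bigunion.
Qed.

Lemma bisim_D3_trans : transitive State bisim_D3.
Proof.
  intros s t u bisim_st bisim_tu; apply bisim_D3_iff_bigunion.
  apply (inclusion_bigunion _
    (rel_compose (rel_bigunion D3_bisimulation)
                 (rel_bigunion D3_bisimulation))).
  - now apply D3_bisimulation_compose_self, D3_bisimulation_bigunion.
  - exists t; split; now apply bisim_D3_iff_bigunion.
Qed.

End Bisimulation.

Theorem theorem1 (A : Type) (tau : A) (State : Type)
    (trans : State -> A -> State -> Prop) :
  equivalence State (bisim_D3 tau trans).
Proof.
  split.
  - apply bisim_D3_refl.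
  - apply bisim_D3_trans.
  - apply bisim_D3_sym.
Qed.
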